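(* Consider an instance of the VRPRB (the bi-objective capacitated vehicle routing problem minimizing the total tour length $C(\mathbf{x})$ and an inequality measure $I(\mathbf{x})$ of the tour lengths). If $I(\mathbf{x})$ is at least weakly monotonic, then every Pareto-optimal solution to the VRPRB is composed only of TSP-optimal tours.
   Context: Capacitated vehicle routing problem (CVRP): given a depot, a finite set of customers with nonnegative demands, nonnegative travel distances between all pairs of locations, a vehicle capacity, and a number $n \ge 2$ of tours. A feasible solution is a collection of $n$ tours, each starting and ending at the depot, such that every customer is visited exactly once by exactly one tour, and the total demand of the customers in each tour does not exceed the capacity. The length of a tour is the sum of the distances travelled along it. A solution is characterized, for the evaluation of the objectives, by the vector $\mathbf{x} = (x_1,\dots,x_n)$ of its workloads, where $x_i$ is the length of its $i$-th tour. $X$ denotes the set of feasible solutions (allocations). The total cost is $C(\mathbf{x}) = \sum_{i=1}^n x_i$. An inequality measure is a function $I$ assigning a real index value $I(\mathbf{x})$ to each allocation $\mathbf{x}\in X$ (a function of the workload vector); smaller is more equitable. The VRPRB is the bi-objective problem of minimizing $C$ and $I$ over $X$. Pareto-optimality: $\mathbf{x}'$ dominates $\mathbf{x}$ if $C(\mathbf{x}') \le C(\mathbf{x})$ and $I(\mathbf{x}') \le I(\mathbf{x})$ with at least one of the two inequalities strict; $\mathbf{x} \in X$ is Pareto-optimal if no $\mathbf{x}' \in X$ dominates it. Weak monotonicity: $I$ is (at least weakly) monotonic if, whenever $\mathbf{x}'$ is formed from $\mathbf{x}$ by $x'_i = x_i + \delta_i$ with $\delta_i \ge 0$ for all $i$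 and $\delta_i>0$ for at least one $i$, then $I(\mathbf{x}') \ge I(\mathbf{x})$. A tour is TSP-optimal if its length is minimal among all tours starting and ending at the depot and visiting exactly the same set of customers. *)

(* Defs.v *)
From mathcomp Require Import all_boot all_order all_algebra.

Set Implicit Arguments.
Unset Strict Implicit.
Unset Printing Implicit Defensive.

Import Order.TTheory GRing.Theory Num.Theory.
Local Open Scope ring_scope.

(* The locations are [option customer], with [None] the depot.  Distances are
   neither assumed symmetric nor to satisfy the triangle inequality. *)
Record cvrp (R : realFieldType) := Cvrp {
  customer : finType;
  demand : customer -> R;
  dist : option customer -> option customer -> R;
  capacity : R;
  ntours : nat;
  demand_ge0 : forall c, 0 <= demand c;
  dist_ge0 : forall u v, 0 <= dist u v;
  ntours_ge2 : (2 <= ntours)%N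
}.

Section Vrprb.
Variables (R : realFieldType) (P : cvrp R).

(* A tour is given by the customers it visits, in order; the departure from and
   the return to the depot are implicit. *)
Definition is_tour (t : seq (customer P)) : bool := uniq t.

(* d(depot, c_1) + d(c_1, c_2) + ... + d(c_k, depot) *)
Definition tour_length (t : seq (customer P)) : R :=
  \sum_(e <- zip (None :: map some t) (rcons (map some t) None)) dist e.1 e.2.

Definition tour_demand (t : seq (customer P)) : R := \sum_(c <- t) demand c.

Definition tsp_optimal (t : seq (customer P)) : Prop :=
  is_tour t /\
  forall t', is_tour t' -> t' =i t -> tour_length t <= tour_length t'.

Definition solution := 'I_(ntours P) -> seq (customer P).

Definition feasible (s : solution) : Prop :=
  [/\ forall i, is_tour (s i),
      forall c : customer P, exists! i, c \in s i
    & forall i, tour_demand (s i) <= capacity P].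

Definition workload (s : solution) : 'rV[R]_(ntours P) :=
  \row_i tour_length (s i).

Definition allocation (x : 'rV[R]_(ntours P)) : Prop :=
  exists2 s, feasible s & x = workload s.

Definition total_cost (x : 'rV[R]_(ntours P)) : R := \sum_i x 0 i.

(* An inequality measure only matters on allocations, so monotonicity is only
   required there; its values at other vectors are irrelevant. *)
Definition weakly_monotonic (I : 'rV[R]_(ntours P) -> R) : Prop :=
  forall x delta : 'rV[R]_(ntours P),
    allocation x -> allocation (x + delta) ->
    (forall i, 0 <= delta 0 i) -> (exists i, 0 < delta 0 i) ->
    I x <= I (x + delta).

Definition dominates (I : 'rV[R]_(ntours P) -> R)
    (x' x : 'rV[R]_(ntours P)) : Prop :=
  [/\ total_cost x' <= total_cost x, I x' <= I x
    & total_cost x' < total_cost x \/ I x' < I x].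

Definition pareto_optimal (I : 'rV[R]_(ntours P) -> R) (s : solution) : Prop :=
  feasible s /\
  forall s', feasible s' -> ~ dominates I (workload s') (workload s).

End Vrprb.

(* Main.v *)
Require Import Defs.
From mathcomp Require Import all_boot all_order all_algebra.

(** If tour [i] of a Pareto-optimal solution were longer than another tour [t]
    of the same customers, [t] could be used in its place: for
    duplicate-free tours, feasibility depends only on the sets of customers
    visited, so it is preserved ([feasible_replace_tour]).  The old workload vector is then the new one plus
    a positive amount in coordinate [i] alone ([workload_replace_tour]).  Hence
    the total cost strictly decreases under the replacement
    ([total_cost_add_delta]), while weak monotonicity, applied from the new
    allocation to the old one, says that the inequality index does not
    increase.  So the new solution dominates the old one, a contradiction. *)

Set Implicit Arguments.
Unset Strict Implicit.
Unset Printing Implicit Defensive.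

Import Order.TTheory GRing.Theory Num.Theory.
Local Open Scope ring_scope.

Definition replace_tour (R : realFieldType) (P : cvrp R) (s : solution P)
    (i : 'I_(ntours P)) (t : seq (customer P)) : solution P :=
  fun j => if j == i then t else s j.

Lemma mem_replace_tour (R : realFieldType) (P : cvrp R) (s : solution P)
    (i : 'I_(ntours P)) (t : seq (customer P)) :
  t =i s i -> forall j, replace_tour s i t j =i s j.
Proof. by rewrite /replace_tour => eq_t j c; case: eqP => [->|]. Qed.

(** Since tours are duplicate-free, two tours of the same customers are
    permutations of each other. *)
Lemma tour_demand_eq_mem (R : realFieldType) (P : cvrp R)
    (t t' : seq (customer P)) :
  is_tour t -> is_tour t' -> t =i t' -> tour_demand t = tour_demand t'.
Proof. by move=> ut ut' eq_t; apply/perm_big/uniq_perm. Qed.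

Lemma feasible_replace_tour (R : realFieldType) (P : cvrp R) (s : solution P)
    (i : 'I_(ntours P)) (t : seq (customer P)) :
  feasible s -> is_tour t -> t =i s i -> feasible (replace_tour s i t).
Proof.
move=> [s_uniq s_part s_cap] ut eq_t; split=> [j|c|j].
- by rewrite /replace_tour; case: ifP.
- have [j [cj j_uniq]] := s_part c.
  exists j; split=> [|k]; rewrite mem_replace_tour //; exact: j_uniq.
- rewrite /replace_tour; case: ifP => // _.
  by rewrite (tour_demand_eq_mem ut (s_uniq i) eq_t).
Qed.

(** The old workload is written as a perturbation of the new one because this is
    the direction in which the coordinates increase when [t] is shorter. *)
Lemma workload_replace_tour (R : realFieldType) (P : cvrp R) (s : solution P)
    (i : 'I_(ntours P)) (t : seq (customer P)) :
  workload s = workload (replace_tour s i t)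
    + (tour_length (s i) - tour_length t) *: delta_mx 0 i.
Proof.
apply/rowP=> j; rewrite !mxE eqxx /replace_tour /=.
by case: eqP => [->|_]; rewrite ?mulr1 ?subrKC ?mulr0 ?addr0.
Qed.

Lemma total_cost_add_delta (R : realFieldType) (P : cvrp R)
    (x : 'rV[R]_(ntours P)) (a : R) (i : 'I_(ntours P)) :
  total_cost (x + a *: delta_mx 0 i) = total_cost x + a.
Proof.
rewrite /total_cost; under eq_bigr => j _ do rewrite !mxE eqxx /=.
rewrite big_split /= -mulr_sumr; congr (_ + _).
rewrite (bigD1 i) //= eqxx big1 ?addr0 ?mulr1 //.
by move=> j /negPf->.
Qed.

Theorem theorem1 (R : realFieldType) (P : cvrp R)
    (I : 'rV[R]_(ntours P) -> R) (hI : weakly_monotonic I)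
    (s : solution P) (hs : pareto_optimal I s) :
  forall i : 'I_(ntours P), tsp_optimal (s i).
Proof.
case: hs => s_feas s_opt i; split=> [|t ut eq_t]; first by case: s_feas.
rewrite leNgt; apply/negP => t_shorter.
pose s' := replace_tour s i t.
have s'_feas : feasible s' by exact: feasible_replace_tour.
have a_gt0 : 0 < tour_length (s i) - tour_length t by rewrite subr_gt0.
have eq_w := workload_replace_tour s i t.
have cost_lt : total_cost (workload s') < total_cost (workload s).
  by rewrite eq_w total_cost_add_delta ltrDl.
apply: (s_opt s' s'_feas); split; [exact: ltW| |by left].
rewrite eq_w; apply: hI.
- by exists s'.
- by rewrite -eq_w; exists s.
- by move=> j; rewrite !mxE mulr_ge0 ?ler0n // ltW.
- by exists i; rewrite !mxE !eqxx mulr1.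
Qed.
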